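(* Let $(A,\{\cdot,\cdot,\cdot\})$ be a nonzero finite-dimensional $3$-pre-Lie algebra over $\mathbb R$ or $\mathbb C$. Then $(A^c\ltimes_{L^*}A^*,\omega,E)$ is a perfect para-Kähler $3$-Lie algebra, where for all $x,y\in A$, $\alpha,\beta\in A^*$, $$\omega(x+\alpha,y+\beta)=\langle\alpha,y\rangle-\langle\beta,x\rangle,\qquad E(x+\alpha)=x-\alpha.$$
   Context: A $3$-Lie algebra is a vector space with a trilinear skew-symmetric bracket satisfying $[x,y,[z,w,v]]=[[x,y,z],w,v]+[z,[x,y,w],v]+[z,w,[x,y,v]]$. A $3$-pre-Lie algebra is a vector space $A$ with a trilinear map $\{\cdot,\cdot,\cdot\}$ such that, with $[x,y,z]_C:=\{x,y,z\}+\{y,z,x\}+\{z,x,y\}$: (1) $\{x,y,z\}=-\{y,x,z\}$; (2) $\{x_1,x_2,\{x_3,x_4,x_5\}\}=\{[x_1,x_2,x_3]_C,x_4,x_5\}+\{x_3,[x_1,x_2,x_4]_C,x_5\}+\{x_3,x_4,\{x_1,x_2,x_5\}\}$; (3) $\{[x_1,x_2,x_3]_C,x_4,x_5\}=\{x_1,x_2,\{x_3,x_4,x_5\}\}+\{x_2,x_3,\{x_1,x_4,x_5\}\}+\{x_3,x_1,\{x_2,x_4,x_5\}\}$. $A^c=(A,[\cdot,\cdot,\cdot]_C)$ is the sub-adjacent $3$-Lie algebra. Put $L(x,y)z=\{x,y,z\}$ and $\langle L^*(x,y)\alpha,z\rangle=-\langle\alpha,L(x,y)z\rangle$. The $3$-Lie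 algebra $A^c\ltimes_{L^*}A^*$ is $A\oplus A^*$ with bracket $[x_1+\alpha_1,x_2+\alpha_2,x_3+\alpha_3]_{L^*}=[x_1,x_2,x_3]_C+L^*(x_1,x_2)\alpha_3+L^*(x_2,x_3)\alpha_1+L^*(x_3,x_1)\alpha_2$. A symplectic structure on a $3$-Lie algebra is a nondegenerate skew-symmetric bilinear form $\omega$ with $\omega([x,y,z],w)-\omega([y,z,w],x)+\omega([z,w,x],y)-\omega([w,x,y],z)=0$. A perfect paracomplex structure is a linear map $E$ with $E^2=\mathrm{Id}$, $E\neq\pm\mathrm{Id}$, $E[x,y,z]=[Ex,Ey,Ez]$, whose $+1$- and $-1$-eigenspaces have the same dimension. A perfect para-Kähler $3$-Lie algebra is a triple $(\mathfrak g,\omega,E)$ with $\omega$ symplectic, $E$ perfect paracomplex and $\omega(Ex,Ey)=-\omega(x,y)$ for all $x,y\in\mathfrak g$. *)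

(* Defs.v *)
From HB Require Import structures.
From mathcomp Require Import all_boot all_order all_algebra.
From mathcomp Require Import reals complex.

Set Implicit Arguments.
Unset Strict Implicit.
Unset Printing Implicit Defensive.

Import GRing.Theory.
Local Open Scope ring_scope.

Section ThreeLie.
Variables (K : fieldType) (V : lmodType K).
Implicit Types br : V -> V -> V -> V.

Definition trilinear br : Prop :=
  [/\ forall y z, linear (fun x => br x y z),
      forall x z, linear (fun y => br x y z)
    & forall x y, linear (fun z => br x y z)].

(* The two adjacent transpositions generate S_3. *)
Definition skew_symmetric3 br : Prop :=
  (forall x y z, br x y z = - br y x z) /\
  (forall x y z, br x y z = - br x z y).

Definition fundamental_identity br : Prop :=
  forall x y z w v,
    br x y (br z w v) =
    br (br x y z) w v + br z (br x y w) v + br z w (br x y v).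

Definition is_3Lie br : Prop :=
  [/\ trilinear br, skew_symmetric3 br & fundamental_identity br].

Definition commutator3 br (x y z : V) : V := br x y z + br y z x + br z x y.

Definition is_3preLie br : Prop :=
  let brC := commutator3 br in
  [/\ trilinear br,
      forall x y z, br x y z = - br y x z,
      forall x1 x2 x3 x4 x5,
        br x1 x2 (br x3 x4 x5) =
        br (brC x1 x2 x3) x4 x5 + br x3 (brC x1 x2 x4) x5
        + br x3 x4 (br x1 x2 x5)
    & forall x1 x2 x3 x4 x5,
        br (brC x1 x2 x3) x4 x5 =
        br x1 x2 (br x3 x4 x5) + br x2 x3 (br x1 x4 x5)
        + br x3 x1 (br x2 x4 x5)].

End ThreeLie.

Section ParaKahler.
Variables (K : fieldType) (V : vectType K).
Implicit Types (br : V -> V -> V -> V) (omega : V -> V -> K) (E : 'End(V)).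

Definition is_symplectic3 br omega : Prop :=
  [/\ bilinear_for *%R *%R omega,
      forall x y, omega x y = - omega y x,
      forall x, (forall y, omega x y = 0) -> x = 0
    & forall x y z w,
        omega (br x y z) w - omega (br y z w) x
        + omega (br z w x) y - omega (br w x y) z = 0].

Definition is_perfect_paracomplex br E : Prop :=
  [/\ (E \o E)%VF = \1%VF,
      E <> \1%VF /\ E <> - \1%VF,
      forall x y z, E (br x y z) = br (E x) (E y) (E z)
    & \dim (passmx.leigenspace E 1) = \dim (passmx.leigenspace E (-1))].

Definition is_perfect_paraKahler_3Lie br omega E : Prop :=
  [/\ is_3Lie br,
      is_symplectic3 br omega,
      is_perfect_paracomplex br E
    & forall x y, omega (E x) (E y) = - omega x y].

End ParaKahler.

Section SemidirectDual.
Variables (K : fieldType) (A : vectType K).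

Definition dualsp : vectType K := 'Hom(A, K^o).

Definition dsum : vectType K := (A * dualsp)%type.

(* [linfun] returns the linear map that agrees with its argument on a basis;
   [dualLE] shows that it is the intended one when [br] is trilinear. *)
Definition dualL (br : A -> A -> A -> A) (x y : A) (a : dualsp) : dualsp :=
  linfun (fun z : A => - a (br x y z) : K^o).

Definition semidirect_bracket (br : A -> A -> A -> A) (u v w : dsum) : dsum :=
  (commutator3 br u.1 v.1 w.1,
   dualL br u.1 v.1 w.2 + dualL br v.1 w.1 u.2 + dualL br w.1 u.1 v.2).

Definition pairing_form (u v : dsum) : K := u.2 v.1 - v.2 u.1.

Definition flip_fun (u : dsum) : dsum := (u.1, - u.2).

Definition flip : 'End(dsum) := linfun flip_fun.

Lemma dualLE br x y (a : dualsp) z :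
  trilinear br -> dualL br x y a z = - a (br x y z).
Proof.
case=> _ _ brl.
have fl : linear (fun z : A => - a (br x y z) : K^o).
  by move=> k u v; rewrite brl linearP opprD scalerN.
pose m := GRing.isLinear.Build _ _ _ _ _ fl.
pose f : {linear A -> K^o} := HB.pack (fun z : A => - a (br x y z) : K^o) m.
exact: (lfunE f z).
Qed.

Lemma flip_fun_is_linear : linear flip_fun.
Proof.
move=> k [x a] [y b]; congr pair => /=.
by rewrite opprD scalerN.
Qed.

HB.instance Definition _ :=
  GRing.isLinear.Build K dsum dsum *:%R flip_fun flip_fun_is_linear.

Lemma flipE (x : A) (a : dualsp) : flip (x, a) = (x, - a).
Proof. by rewrite lfunE. Qed.

End SemidirectDual.

(* Main.v *)
Require Import Defs.
From mathcomp Require Import all_boot all_order all_algebra.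
From mathcomp Require Import reals complex.
From mathcomp Require Import ring.

(** The bracket, the form and the involution on [A + A^*] are explicit, so every
    clause is an identity to be tested componentwise.  Vectors of [A] are
    separated by linear functionals ([eq_vector]) and functionals by their
    values, so all these identities become identities between scalars of the
    shape [<f, {a, b, {c, d, e}}>].  They then follow by ring arithmetic, once
    the pre-Lie axioms have been used on the right terms.

    The fundamental identity carries the mathematical content.  On [A] it says
    that the sub-adjacent bracket is a 3-Lie bracket
    ([commutator3_fundamental]).  On [A^*] it says that [L^*] is a
    representation, which amounts to two identities for [L], corresponding to
    the position of the dual argument.  If this argument is one of the three
    innermost ones, the identity needed is the second pre-Lie axiom.  If it is
    one of the two outer ones, dualizing reverses the order of composition: the
    third axiom gives
      [L([z,w,v],y) = L(z,w) L(v,y) + L(w,v) L(z,y) + L(v,z) L(w,y)],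
    whereas
      [L([z,w,v],y) = L(y,z) L(w,v) + L(y,w) L(v,z) + L(y,v) L(z,w)]
    is required.  The two right-hand sides agree when 3 is invertible
    ([br_commutator3_swap]).

    The form is closed because, when exactly one argument [d] is dual, its four
    terms add up to [- <d, [x,y,z]_C>] plus the three summands of
    [<d, [x,y,z]_C>].  It is nondegenerate because functionals separate points.

    The eigenspaces of [E] are [A] and [A^*] when 2 is invertible, and these
    have the same dimension.  Hence the statement holds over every field of
    characteristic other than 2 and 3 ([preLie_paraKahler]), in particular over
    the real and the complex numbers. *)

Set Implicit Arguments.
Unset Strict Implicit.
Unset Printing Implicit Defensive.

Import GRing.Theory Num.Theory.
Local Open Scope ring_scope.
Local Open Scope complex_scope.

(** * Duality between a space and its dual *)

Section Pairing.
Variables (K : fieldType) (A : vectType K).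
Implicit Types (f g : dualsp A) (x y : A) (k : K).

(** The values of a functional lie in the regular module [K^o]; typing them in
    the field [K] turns scaling into multiplication, as [ring] expects. *)
Definition pairing f x : K := f x.

Lemma pairingDr f x y : pairing f (x + y) = pairing f x + pairing f y.
Proof. exact: (raddfD f). Qed.

Lemma pairingNr f x : pairing f (- x) = - pairing f x.
Proof. exact: (raddfN f). Qed.

Lemma pairing0r f : pairing f 0 = 0.
Proof. exact: (raddf0 f). Qed.

Lemma pairingZr f k x : pairing f (k *: x) = k * pairing f x.
Proof. by rewrite /pairing linearZ. Qed.

Lemma pairingDl f g x : pairing (f + g) x = pairing f x + pairing g x.
Proof. by rewrite /pairing add_lfunE. Qed.

Lemma pairingNl f x : pairing (- f) x = - pairing f x.
Proof. by rewrite /pairing opp_lfunE. Qed.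

Lemma pairing0l x : pairing 0 x = 0.
Proof. by rewrite /pairing zero_lfunE. Qed.

Lemma pairingZl k f x : pairing (k *: f) x = k * pairing f x.
Proof. by rewrite /pairing scale_lfunE. Qed.

Definition pairingE :=
  (pairingDr, pairingNr, pairingZr, pairingDl, pairingNl, pairingZl).

Lemma eq_functional f g : (forall x, pairing f x = pairing g x) -> f = g.
Proof. by move=> fg; apply/lfunP. Qed.

(** The coordinate functionals of a basis already separate points. *)
Lemma eq_vector x y : (forall f, pairing f x = pairing f y) -> x = y.
Proof.
move=> xy; rewrite (coord_vbasis (memvf x)) (coord_vbasis (memvf y)).
apply: eq_bigr => i _; congr (_ *: _).
have := xy (linfun (coord (vbasis fullv) i : A -> K^o)).
by rewrite /pairing !lfunE.
Qed.

Lemma eq_dsum (u v : dsum A) :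
  u.1 = v.1 -> (forall t, pairing u.2 t = pairing v.2 t) -> u = v.
Proof. by case: u v => [x a] [y b] /= -> /eq_functional ->. Qed.

Lemma pairing_dualL (br : A -> A -> A -> A) x y f t :
  trilinear br -> pairing (dualL br x y f) t = - pairing f (br x y t).
Proof. exact: dualLE. Qed.

End Pairing.

(** Deduces an equation from its expression as the sum of three others, a
    combination that [ring] can then verify. *)
Lemma eq_sub_sum3 (V : zmodType) (a b a1 b1 a2 b2 a3 b3 : V) :
    a1 = b1 -> a2 = b2 -> a3 = b3 ->
  a - b = (a1 - b1) + (a2 - b2) + (a3 - b3) -> a = b.
Proof. by move=> -> -> -> /eqP; rewrite !subrr !addr0 subr_eq0 => /eqP. Qed.

(** * The sub-adjacent bracket *)

Section PreLie.
Variables (K : fieldType) (A : vectType K) (br : A -> A -> A -> A).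
Hypothesis br_preLie : is_3preLie br.
Local Notation C := (commutator3 br).

Let br_tri : trilinear br. Proof. by case: br_preLie. Qed.

Lemma brP1 k u v y z : br (k *: u + v) y z = k *: br u y z + br v y z.
Proof. by case: br_tri => + _ _; apply. Qed.

Lemma brP2 k u v x z : br x (k *: u + v) z = k *: br x u z + br x v z.
Proof. by case: br_tri => _ + _; apply. Qed.

Lemma brP3 k u v x y : br x y (k *: u + v) = k *: br x y u + br x y v.
Proof. by case: br_tri => _ _; apply. Qed.

Lemma brD3 x y u v : br x y (u + v) = br x y u + br x y v.
Proof. by have := brP3 1 u v x y; rewrite !scale1r. Qed.

Lemma brN3 x y u : br x y (- u) = - br x y u.
Proof.
have br0 : br x y 0 = 0.
  by have := brP3 (-1) u u x y; rewrite !scaleN1r !addNr.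
by apply: (addrI (br x y u)); rewrite -brD3 !subrr.
Qed.

Lemma br_skew x y z : br x y z = - br y x z.
Proof. by case: br_preLie. Qed.

Lemma br_comm x1 x2 x3 x4 x5 :
  br x1 x2 (br x3 x4 x5) =
  br (C x1 x2 x3) x4 x5 + br x3 (C x1 x2 x4) x5 + br x3 x4 (br x1 x2 x5).
Proof. by case: br_preLie. Qed.

Lemma br_commutator3 x1 x2 x3 x4 x5 :
  br (C x1 x2 x3) x4 x5 =
  br x1 x2 (br x3 x4 x5) + br x2 x3 (br x1 x4 x5) + br x3 x1 (br x2 x4 x5).
Proof. by case: br_preLie. Qed.

(** Linearity in the first argument suffices: the other two follow by
    rotation. *)
Lemma commutator3P k u v y z : C (k *: u + v) y z = k *: C u y z + C v y z.
Proof.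
by apply: eq_vector => f; rewrite /commutator3 brP1 brP2 brP3 !pairingE; ring.
Qed.

Lemma commutator3_rot x y z : C x y z = C y z x.
Proof. by rewrite /commutator3 -addrA addrC. Qed.

Lemma commutator3_skew12 x y z : C x y z = - C y x z.
Proof.
rewrite /commutator3 (br_skew x y) (br_skew y z) (br_skew z x).
by rewrite !opprD addrAC.
Qed.

Lemma commutator3E x y z : C x y z = br x y z - br x z y + br y z x.
Proof. by rewrite /commutator3 (br_skew x z) opprK addrAC. Qed.

(** Expanding [{x,y,[z,w,v]_C}] by the second axiom gives all the terms of the
    right-hand side in which an inner commutator sits in one of the first two
    slots.  What is left is the difference [{[z,w,v]_C,x,y} - {[z,w,v]_C,y,x}],
    which the third axiom turns into the remaining terms. *)
Lemma commutator3_fundamental : fundamental_identity C.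
Proof.
move=> x y z w v.
have br_xyC : br x y (C z w v) =
    br (C x y z) w v - br (C x y w) z v + br z w (br x y v)
    + (br (C x y w) v z - br (C x y v) w z + br w v (br x y z))
    + (br (C x y v) z w - br (C x y z) v w + br v z (br x y w)).
  rewrite {1}/commutator3 !brD3 (br_comm x y z) (br_comm x y w) (br_comm x y v).
  by rewrite (br_skew z (C x y w)) (br_skew w (C x y v)) (br_skew v (C x y z)).
have br_C a b c d e :
    br a b (C c d e) =
    br a b (br c d e) + br a b (br d e c) + br a b (br e c d).
  by rewrite {1}/commutator3 !brD3.
(* Each outer commutator is rotated so that the inner one comes first. *)
rewrite (commutator3_rot x y (C z w v)) (commutator3_rot y (C z w v)).
rewrite (commutator3_rot z (C x y w)).
rewrite (commutator3_rot z w (C x y v)) (commutator3_rot w (C x y v)).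
rewrite !(commutator3E (C _ _ _)) br_xyC 3!br_C (br_commutator3 z w v x y).
rewrite (br_commutator3 z w v y x).
rewrite (br_skew v y x) (br_skew z y x) (br_skew w y x) !brN3.
by apply: eq_vector => f; rewrite !pairingE; ring.
Qed.

(** Let [S] be the right-hand side and [S'] the sum of the same products of
    operators in the opposite order.  The third axiom says that the left-hand
    side is [- S'].  Summing the second axiom over the three commutators
    [L(y,z) L(w,v) - L(w,v) L(y,z)], etc., and expanding by the third axiom
    yields [S - S' = 2 (2 S + S')], that is [3 (S + S') = 0]. *)
Lemma br_commutator3_swap y z w v t : (3%:R : K) != 0 ->
  br (C z w v) y t =
  br y z (br w v t) + br y w (br v z t) + br y v (br z w t).
Proof.
move=> nz3.
move: (br_comm y z w v t) (br_comm y w v z t) (br_comm y v z w t).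
rewrite (br_skew w (C y z v)) (br_skew v (C y w z)) (br_skew z (C y v w)).
rewrite !br_commutator3 => h1 h2 h3; apply: eq_vector => f.
move: (congr1 (pairing f) h1) (congr1 (pairing f) h2) (congr1 (pairing f) h3).
(* The six pairs of arguments are oriented as they appear in the sum [S]. *)
rewrite !(br_skew v w) !(br_skew w z) !(br_skew z v).
rewrite !(br_skew z y) !(br_skew w y) !(br_skew v y) !brN3 !pairingE.
move=> {}h1 {}h2 {}h3; apply: (mulfI nz3); apply: (eq_sub_sum3 h1 h2 h3); ring.
Qed.

(** * The semidirect product and its symplectic form *)

Let L_dualE x y (a : dualsp A) t :
  pairing (dualL br x y a) t = - pairing a (br x y t).
Proof. exact: pairing_dualL. Qed.

Local Notation sbr := (semidirect_bracket br).

Lemma semidirect_rot u v w : sbr u v w = sbr v w u.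
Proof.
apply: eq_dsum => [|t] /=; first exact: commutator3_rot.
by rewrite !pairingE; ring.
Qed.

Lemma semidirectP k u v y z : sbr (k *: u + v) y z = k *: sbr u y z + sbr v y z.
Proof.
apply: eq_dsum => [|t] /=; first exact: commutator3P.
by rewrite !(pairingE, L_dualE, brP1, brP2); ring.
Qed.

Lemma semidirect_skew12 u v w : sbr u v w = - sbr v u w.
Proof.
apply: eq_dsum => [|t] /=; first exact: commutator3_skew12.
rewrite !(pairingE, L_dualE) (br_skew u.1 v.1) (br_skew v.1 w.1).
by rewrite (br_skew w.1 u.1) !pairingE; ring.
Qed.

Lemma semidirect_3Lie : (3%:R : K) != 0 -> is_3Lie sbr.
Proof.
move=> nz3; split.
- split=> [y z|x z|x y] k u v /=; first exact: semidirectP.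
    by rewrite !(semidirect_rot x) semidirectP.
  by rewrite -!(semidirect_rot _ x) semidirectP.
- split=> [x y z|x y z]; first exact: semidirect_skew12.
  by rewrite semidirect_rot semidirect_skew12 (semidirect_rot x z).
- move=> [x a] [y b] [z c] [w d] [v e].
  apply: eq_dsum => [|t] /=; first exact: commutator3_fundamental.
  rewrite !(pairingE, L_dualE).
  (* The dual arguments [c], [d], [e] call for the second axiom, the outer ones
     [a] and [b] for the order-reversed form of the third. *)
  rewrite (br_comm x y z w) (br_comm x y w v) (br_comm x y v z).
  rewrite (br_skew y (C z w v)) !(br_commutator3_swap _ z w v _ nz3).
  rewrite (br_skew x z) (br_skew x w) (br_skew x v) !pairingE.
  ring.
Qed.

Lemma semidirect_symplectic : is_symplectic3 sbr (@pairing_form K A).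
Proof.
have formE u v : pairing_form u v = pairing u.2 v.1 - pairing v.2 u.1 by [].
split.
- by split=> [v|u] k x y /=; rewrite !formE /= !pairingE; ring.
- by move=> x y; rewrite !formE opprB.
- (* Test against [0 + f] for the first component, [t + 0] for the second. *)
  move=> u u0; apply: eq_dsum => [|t] /=.
    apply: eq_vector => f; have := u0 (0, f); rewrite formE /= !pairing0r sub0r.
    by move/eqP; rewrite oppr_eq0 => /eqP.
  by have := u0 (t, 0); rewrite formE /= !pairing0l subr0.
- move=> [x a] [y b] [z c] [w d]; rewrite !formE /=.
  rewrite /commutator3 !(pairingE, L_dualE).
  rewrite !(br_skew z x) !(br_skew w x) !(br_skew w y) !pairingE.
  ring.
Qed.

End PreLie.

(** * The paracomplex structure *)

Section Flip.
Variables (K : fieldType) (A : vectType K).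
Hypothesis nz2 : (2%:R : K) != 0.

Lemma flip_pairing_form u v :
  pairing_form (flip A u) (flip A v) = - pairing_form u v.
Proof.
case: u v => [x a] [y b]; rewrite !flipE /pairing_form /=.
rewrite -/(pairing (- a) y) -/(pairing (- b) x) !pairingE /pairing.
by rewrite opprB opprK addrC.
Qed.

Lemma flipP u : flip A u = (u.1, - u.2).
Proof. by rewrite lfunE. Qed.

Lemma flip_involutive : (flip A \o flip A)%VF = \1%VF.
Proof.
by apply/lfunP => -[x a]; rewrite comp_lfunE !flipE opprK id_lfunE.
Qed.

(** The bracket respects the grading of [A + A^*] by parity: it vanishes as soon
    as two arguments are dual, and is dual when exactly one of them is. *)
Lemma semidirect_flip (br : A -> A -> A -> A) u v w :
  trilinear br ->
  flip A (semidirect_bracket br u v w) =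
  semidirect_bracket br (flip A u) (flip A v) (flip A w).
Proof.
move=> br_tri; case: u v w => [x a] [y b] [z c].
rewrite !flipP /semidirect_bracket /=; apply: eq_dsum => //= t.
by rewrite !(pairingE, pairing_dualL _ _ _ _ br_tri); ring.
Qed.

Lemma dim_dualsp : \dim {:dualsp A} = \dim {:A}.
Proof. by rewrite !dimvf; exact: muln1. Qed.

Lemma double_eq0 (V : lmodType K) (v : V) : (v + v == 0) = (v == 0).
Proof. by rewrite -mulr2n -scaler_nat scaler_eq0 (negPf nz2). Qed.

Lemma mem_eigenspace_flip1 u :
  (u \in passmx.leigenspace (flip A) 1) = (u.2 == 0).
Proof.
case: u => x a; rewrite memv_ker add_lfunE opp_lfunE scale_lfunE id_lfunE.
rewrite flipP scale1r -[_ - _]/(x - x, - a - a) subrr -opprD.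
by rewrite xpair_eqE eqxx oppr_eq0 double_eq0.
Qed.

Lemma mem_eigenspace_flipN1 u :
  (u \in passmx.leigenspace (flip A) (-1)) = (u.1 == 0).
Proof.
case: u => x a; rewrite memv_ker add_lfunE opp_lfunE scale_lfunE id_lfunE.
rewrite flipP scaleN1r opprK -[_ + _]/(x + x, - a + a) addNr.
by rewrite xpair_eqE eqxx andbT double_eq0.
Qed.

Lemma dim_eq_lfun (U W : vectType K) (f : 'Hom(U, W)) (S : {vspace U}) :
    (forall u, u \in S -> f u = 0 -> u = 0) ->
    (forall w, exists2 u, u \in S & f u = w) -> \dim S = \dim {:W}.
Proof.
move=> f_inj f_surj; rewrite -(@limg_dim_eq _ _ _ f).
  congr (\dim _); apply/vspaceP => w; rewrite memvf.
  by have [u uS <-] := f_surj w; rewrite memv_img.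
apply/eqP; rewrite -subv0; apply/subvP => u; rewrite memv_cap memv_ker memv0.
by case/andP=> uS /eqP /(f_inj u uS) ->.
Qed.

Lemma dim_eigenspace_flip1 :
  \dim (passmx.leigenspace (flip A) 1) = \dim {:A}.
Proof.
apply: (@dim_eq_lfun _ _ (linfun (fst : dsum A -> A))) => [[x a]|x].
  by rewrite mem_eigenspace_flip1 lfunE /= => /eqP -> ->.
by exists (x, 0); rewrite ?mem_eigenspace_flip1 ?lfunE.
Qed.

Lemma dim_eigenspace_flipN1 :
  \dim (passmx.leigenspace (flip A) (-1)) = \dim {:A}.
Proof.
rewrite -dim_dualsp.
apply: (@dim_eq_lfun _ _ (linfun (snd : dsum A -> dualsp A))) => [[x a]|a].
  by rewrite mem_eigenspace_flipN1 lfunE /= => /eqP -> ->.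
by exists (0, a); rewrite ?mem_eigenspace_flipN1 ?lfunE.
Qed.

(** Since [A] is nonzero, so are both eigenspaces; this excludes [E = Id] and
    [E = - Id], for which one of them would vanish. *)
Lemma flip_perfect_paracomplex (br : A -> A -> A -> A) :
    (0 < \dim {:A})%N -> trilinear br ->
  is_perfect_paracomplex (semidirect_bracket br) (flip A).
Proof.
move=> A_gt0 br_tri; split.
- exact: flip_involutive.
- have dim_gt0 c : \dim (passmx.leigenspace (flip A) c) = \dim {:A} ->
      passmx.leigenspace (flip A) c != 0%VS.
    by move=> dim_c; rewrite -dimv_eq0 dim_c -lt0n.
  split=> flip_id.
    have /eqP[] := dim_gt0 (-1) dim_eigenspace_flipN1.
    apply/vspaceP => u; rewrite memv0 memv_ker flip_id !lfun_simp /=.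
    by rewrite scaleN1r opprK double_eq0.
  have /eqP[] := dim_gt0 1 dim_eigenspace_flip1.
  apply/vspaceP => u; rewrite memv0 memv_ker flip_id !lfun_simp /=.
  by rewrite scale1r -opprD oppr_eq0 double_eq0.
- by move=> x y z; exact: semidirect_flip.
- by apply: etrans dim_eigenspace_flip1 _; apply/esym/dim_eigenspace_flipN1.
Qed.
End Flip.

(** * Para-Kähler structures from 3-pre-Lie algebras *)

Lemma preLie_paraKahler (K : fieldType) (A : vectType K)
    (br : A -> A -> A -> A) :
    (2%:R : K) != 0 -> (3%:R : K) != 0 -> (0 < \dim {:A})%N ->
  is_3preLie br ->
  is_perfect_paraKahler_3Lie
    (semidirect_bracket br) (@pairing_form K A) (flip A).
Proof.
move=> nz2 nz3 A_gt0 br_preLie; have [br_tri _ _ _] := br_preLie.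
split.
- exact: semidirect_3Lie.
- exact: semidirect_symplectic.
- exact: flip_perfect_paracomplex.
- exact: flip_pairing_form.
Qed.

Theorem proposition8p2 (R : realType) :
  (forall (A : vectType R) (br : A -> A -> A -> A),
     (0 < \dim {:A})%N -> is_3preLie br ->
     is_perfect_paraKahler_3Lie
       (semidirect_bracket br) (@pairing_form R A) (flip A))
  /\
  (forall (A : vectType R[i]) (br : A -> A -> A -> A),
     (0 < \dim {:A})%N -> is_3preLie br ->
     is_perfect_paraKahler_3Lie
       (semidirect_bracket br) (@pairing_form R[i] A) (flip A)).
Proof.
by split=> A br A_gt0 br_preLie; apply: preLie_paraKahler => //;
  rewrite pnatr_eq0.
Qed.
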